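(* The following data form a bicategory $\mathfrak{IC}$: (1) the $0$-arrows are inverse semigroups; (2) for inverse semigroups $S,T$, the category $\mathfrak{IC}(S,T)$ has as objects ($1$-arrows $S\to T$) the non-degenerate inverse correspondences from $S$ to $T$ and as morphisms ($2$-arrows) the correspondence maps, with usual composition of maps and identity maps; (3) for inverse semigroups $S_1,S_2,S_3$, the composition functor $\mathfrak{IC}(S_1,S_2)\times\mathfrak{IC}(S_2,S_3)\to\mathfrak{IC}(S_1,S_3)$ is given by the tensor product, $(\mathcal{U}_1,\mathcal{U}_2)\mapsto\mathcal{U}_1\otimes\mathcal{U}_2$ on objects and $(\sigma_1,\sigma_2)\mapsto\sigma_1\otimes\sigma_2$, $(\sigma_1\otimes\sigma_2)(u_1\otimes u_2)=\sigma_1(u_1)\otimes\sigma_2(u_2)$, on morphisms; (4) the associativity isomorphisms are the maps $\mathcal{U}_1\otimes(\mathcal{U}_2\otimes\mathcal{U}_3)\to(\mathcal{U}_1\otimes\mathcal{U}_2)\otimes\mathcal{U}_3$, $u_1\otimes(u_2\otimes u_3)\mapsto(u_1\otimes u_2)\otimes u_3$, for non-degenerate inverse correspondences $\mathcal{U}_i:S_i\to S_{i+1}$, $i=1,2,3$; (5) the unit $1$-arrow of an inverse semigroup $S$ is $S$ regarded as an inverse correspondence from $S$ to $S$; (6) the unit isomorphisms for a non-degenerate inverse correspondence $\mathcal{U}:S\to T$ are $\mathcal{U}\otimes T\to\mathcal{U}$, $u\otimes t\mapsto ut$, and $S\otimes\mathcal{U}\to\mathcal{U}$, $s\otimes u\mapsto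 su$.
   Context: A semigroup $T$ is inverse if every $t\in T$ has a unique $t^*\in T$ (its generalized inverse) with $tt^*t=t$ and $t^*tt^*=t^*$. A right $T$-set is a set $\mathcal{U}$ with a map $\mathcal{U}\times T\to\mathcal{U}$, $(u,t)\mapsto ut$, such that $(ut)t'=u(tt')$. A right regular $T$-set is a right $T$-set $\mathcal{U}$ with a map $\langle\cdot|\cdot\rangle_{\mathcal{U}}:\mathcal{U}\times\mathcal{U}\to T$ (the right pairing) such that for all $u,u'\in\mathcal{U}$, $t\in T$: (R-i) $\langle u|u't\rangle_{\mathcal{U}}=\langle u|u'\rangle_{\mathcal{U}}t$; (R-ii) $\langle u|u'\rangle_{\mathcal{U}}^*=\langle u'|u\rangle_{\mathcal{U}}$; (R-iii) $u\langle u|u\rangle_{\mathcal{U}}=u$. A right inverse $T$-set is a right regular $T$-set such that moreover (R-iv) $u\langle u'|u\rangle_{\mathcal{U}}=u$ and $u'\langle u|u'\rangle_{\mathcal{U}}=u'$ imply $u=u'$, for all $u,u'\in\mathcal{U}$. A map $\varphi:\mathcal{U}\to\mathcal{U}$ is adjointable if there is a map $\psi:\mathcal{U}\to\mathcal{U}$ with $\langle\psi(v)|u\rangle_{\mathcal{U}}=\langle v|\varphi(u)\rangle_{\mathcal{U}}$ for all $u,v\in\mathcal{U}$; $L(\mathcal{U})$ denotes the inverse semigroup of adjointable maps on $\mathcal{U}$ under composition. An inverse correspondence $\mathcal{U}:S\to T$ is a right inverse $T$-set $\mathcal{U}$ with a semigroup homomorphism $\theta_{\mathcal{U}}:S\to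 L(\mathcal{U})$; write $su=\theta_{\mathcal{U}}(s)(u)$. It is non-degenerate if $\{su\mid s\in S,u\in\mathcal{U}\}=\mathcal{U}$. A correspondence map $\sigma:\mathcal{U}\to\mathcal{U}'$ between inverse correspondences from $S$ to $T$ is a map with $\sigma(su)=s\sigma(u)$ and $\langle\sigma(u)|\sigma(u')\rangle_{\mathcal{U}'}=\langle u|u'\rangle_{\mathcal{U}}$ for all $s\in S$, $u,u'\in\mathcal{U}$. Tensor product: for inverse correspondences $\mathcal{U}:S_1\to S_2$ and $\mathcal{V}:S_2\to S_3$, $\mathcal{U}\otimes\mathcal{V}$ is the quotient of $\mathcal{U}\times\mathcal{V}$ by the least equivalence relation with $(us_2,v)\sim(u,s_2v)$ for all $u\in\mathcal{U}$, $v\in\mathcal{V}$, $s_2\in S_2$; the class of $(u,v)$ is $u\otimes v$. It is an inverse correspondence from $S_1$ to $S_3$ with $(u\otimes v)s_3=u\otimes(vs_3)$, $\langle u'\otimes v'|u\otimes v\rangle_{\mathcal{U}\otimes\mathcal{V}}=\langle v'|\langle u'|u\rangle_{\mathcal{U}}v\rangle_{\mathcal{V}}$ and $s_1(u\otimes v)=(s_1u)\otimes v$. An inverse semigroup $S$ is regarded as an inverse correspondence from $S$ to $S$ with left and right actions given by multiplication and right pairing $\langle s|s'\rangle_S=s^*s'$. A bicategory is meant in the standard (Bénabou) sense: hom-categories, composition functors, unit $1$-arrows, natural invertible associators and left and right unitors, satisfying the pentagon and triangle identities. *)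

(* Defs.v *)
From HB Require Import structures.
From Stdlib Require Import Relation_Operators.
From mathcomp Require Import all_boot.
From mathcomp Require Import boolp.

Set Implicit Arguments.
Unset Strict Implicit.
Unset Printing Implicit Defensive.

Local Open Scope group_scope.
Local Open Scope quotient_scope.

Definition is_ginv (T : semigroupType) (t t' : T) : Prop :=
  t * t' * t = t /\ t' * t * t' = t'.

HB.mixin Record Semigroup_isInverse T of Semigroup T := {
  ginv_ex1 : forall t : T, exists! t' : T, is_ginv t t'
}.

(* The choiceType structure underlying semigroupType is no restriction: boolp
   provides one on every type. *)
#[short(type="inverseSemigroup")]
HB.structure Definition InverseSemigroup :=
  {T of Semigroup_isInverse T & Semigroup T}.

Definition star (T : inverseSemigroup) (t : T) : T := sval (cid (ginv_ex1 t)).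

Section InverseSemigroupTheory.
Variable T : inverseSemigroup.
Implicit Types a b e f t : T.

Lemma star_ginv t : is_ginv t (star t).
Proof. by have [] := svalP (cid (ginv_ex1 t)). Qed.

Lemma star_uniq t t' : is_ginv t t' -> star t = t'.
Proof. by have [_ h] := svalP (cid (ginv_ex1 t)); exact: h. Qed.

Lemma mulKstar t : t * star t * t = t.
Proof. by case: (star_ginv t). Qed.

Lemma starK t : star (star t) = t.
Proof. by apply: star_uniq; case: (star_ginv t). Qed.

Lemma mulstarK t : star t * t * star t = star t.
Proof. by case: (star_ginv t). Qed.

Lemma star_idem e : e * e = e -> star e = e.
Proof. by move=> ee; apply: star_uniq; split; rewrite !ee. Qed.

Lemma idemM e f : e * e = e -> f * f = f -> (e * f) * (e * f) = e * f.
Proof.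
move=> ee ff; set x := star (e * f).
have xE : x = f * x * e.
  apply: star_uniq; split.
    rewrite !mulgA -(mulgA e f f) ff -(mulgA (e * f * x) e e) ee.
    by rewrite -(mulgA (e * f * x)) mulKstar.
  rewrite !mulgA -(mulgA (f * x) e e) ee -(mulgA (f * x * e) f f) ff.
  transitivity (f * (x * (e * f) * x) * e); first by rewrite !mulgA.
  by rewrite mulstarK.
have xx : x * x = x.
  rewrite {1 2}xE; transitivity (f * (x * (e * f) * x) * e).
    by rewrite !mulgA.
  by rewrite mulstarK -xE.
by rewrite -(starK (e * f)) -/x (star_idem xx) xx.
Qed.

Lemma idemC e f : e * e = e -> f * f = f -> e * f = f * e.
Proof.
move=> ee ff; rewrite -[LHS]star_idem; last exact: idemM.
apply: star_uniq; split.
- rewrite !mulgA -(mulgA e f f) ff -(mulgA (e * f) e e) ee.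
  by rewrite -mulgA idemM.
- rewrite !mulgA -(mulgA f e e) ee -(mulgA (f * e) f f) ff.
  by rewrite -mulgA idemM.
Qed.

Lemma idem_mulstar t : (t * star t) * (t * star t) = t * star t.
Proof. by rewrite mulgA mulKstar. Qed.

Lemma idem_starmul t : (star t * t) * (star t * t) = star t * t.
Proof. by rewrite mulgA mulstarK. Qed.

Lemma starM a b : star (a * b) = star b * star a.
Proof.
have H := idemC (idem_mulstar b) (idem_starmul a).
apply: star_uniq; split.
- transitivity (a * ((b * star b) * (star a * a)) * b); first by rewrite !mulgA.
  rewrite H; transitivity ((a * star a * a) * (b * star b * b)).
    by rewrite !mulgA.
  by rewrite !mulKstar.
- transitivity (star b * ((star a * a) * (b * star b)) * star a).
    by rewrite !mulgA.
  rewrite -H; transitivity ((star b * b * star b) * (star a * a * star a)).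
    by rewrite !mulgA.
  by rewrite !mulstarK.
Qed.

End InverseSemigroupTheory.

Record rightSet (T : inverseSemigroup) := RightSet {
  rset_sort :> Type;
  ract : rset_sort -> T -> rset_sort;
  ractM : forall u t t', ract (ract u t) t' = ract u (t * t')
}.

Record rightRegularSet (T : inverseSemigroup) := RightRegularSet {
  rreg_set :> rightSet T;
  rpair : rreg_set -> rreg_set -> T;
  rpair_ract : forall u u' t, rpair u (ract u' t) = rpair u u' * t;
  rpair_star : forall u u', star (rpair u u') = rpair u' u;
  ract_rpair : forall u, ract u (rpair u u) = u
}.

Record rightInverseSet (T : inverseSemigroup) := RightInverseSet {
  rinv_set :> rightRegularSet T;
  rpair_anti : forall u u' : rinv_set,
    ract u (rpair u' u) = u -> ract u' (rpair u u') = u' -> u = u'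
}.

Definition adjoint (T : inverseSemigroup) (U : rightRegularSet T)
    (phi psi : U -> U) : Prop :=
  forall u v : U, rpair (psi v) u = rpair v (phi u).

Definition adjointable (T : inverseSemigroup) (U : rightRegularSet T)
    (phi : U -> U) : Prop := exists psi : U -> U, adjoint phi psi.

Record adjMap (T : inverseSemigroup) (U : rightInverseSet T) := AdjMap {
  adj_fun :> U -> U;
  adj_funP : adjointable adj_fun
}.

Section AdjointableTheory.
Variables (T : inverseSemigroup) (U : rightInverseSet T).
Implicit Types (u v w : U) (phi psi : U -> U).

Lemma ractl_rpair u t v : rpair (ract u t) v = star t * rpair u v.
Proof. by rewrite -rpair_star rpair_ract starM rpair_star. Qed.

Lemma rpairuu u : rpair u u * rpair u u = rpair u u.
Proof. by rewrite -rpair_ract ract_rpair. Qed.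

Lemma rpair_eq u v :
  rpair u u = rpair u v -> rpair v v = rpair u v -> u = v.
Proof.
move=> uE vE; apply: rpair_anti.
  by rewrite -rpair_star -uE rpair_star ract_rpair.
by rewrite -vE ract_rpair.
Qed.

Lemma rpair_injr u v : (forall w, rpair w u = rpair w v) -> u = v.
Proof.
move=> h; apply: rpair_eq; first exact: h.
by rewrite -[RHS]rpair_star h rpair_star.
Qed.

Lemma adjoint_sym phi psi : adjoint phi psi -> adjoint psi phi.
Proof. by move=> h u v; rewrite -rpair_star -h rpair_star. Qed.

Lemma adjoint_uniq phi psi psi' :
  adjoint phi psi -> adjoint phi psi' -> psi =1 psi'.
Proof.
move=> h h' v; apply: rpair_injr => w.
by rewrite -(rpair_star (psi v)) -(rpair_star (psi' v)) h h'.
Qed.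

Lemma adjointable_ract phi :
  adjointable phi -> forall u t, phi (ract u t) = ract (phi u) t.
Proof.
case=> psi h u t; apply: rpair_injr => w.
by rewrite -h !rpair_ract h.
Qed.

Lemma adjoint_comp phi1 psi1 phi2 psi2 :
  adjoint phi1 psi1 -> adjoint phi2 psi2 ->
  adjoint (phi1 \o phi2) (psi2 \o psi1).
Proof. by move=> h1 h2 u v /=; rewrite h2 h1. Qed.

Lemma adjoint_regular phi psi :
  adjoint phi psi -> phi \o psi \o phi =1 phi.
Proof.
move=> h u /=; have h' := adjoint_sym h.
have lphi : forall u t, phi (ract u t) = ract (phi u) t.
  by apply: adjointable_ract; exists psi.
have lpsi : forall u t, psi (ract u t) = ract (psi u) t.
  by apply: adjointable_ract; exists phi.
set q := rpair (psi (phi u)) (psi (phi u)).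
have tq : rpair (phi u) (phi u) * q = rpair (phi u) (phi u).
  by rewrite h' -rpair_ract /q ract_rpair.
have phiq : ract (phi u) q = phi u.
  by rewrite -{1}(ract_rpair (phi u)) ractM tq ract_rpair.
apply: rpair_anti.
  have -> : rpair (phi u) (phi (psi (phi u))) = q by rewrite -h.
  by rewrite -lphi -lpsi phiq.
have -> : rpair (phi (psi (phi u))) (phi u) = q.
  by rewrite -rpair_star -h rpair_star.
exact: phiq.
Qed.

HB.instance Definition _ := gen_eqMixin (adjMap U).
HB.instance Definition _ := gen_choiceMixin (adjMap U).

Lemma adjMap_ext (phi psi : adjMap U) : phi =1 psi -> phi = psi.
Proof.
case: phi psi => f fP [g gP] /= /funext fg; case: g / fg gP => gP.
by rewrite (Prop_irrelevance fP gP).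
Qed.

Lemma adjMap_comp_adjointable (phi psi : adjMap U) : adjointable (phi \o psi).
Proof.
case: (adj_funP phi) => phi' h; case: (adj_funP psi) => psi' h'.
by exists (psi' \o phi'); exact: adjoint_comp.
Qed.

Definition adjMap_comp (phi psi : adjMap U) : adjMap U :=
  AdjMap (adjMap_comp_adjointable phi psi).

Lemma adjMap_compA : associative adjMap_comp.
Proof. by move=> phi psi chi; exact: adjMap_ext. Qed.

HB.instance Definition _ := isSemigroup.Build (adjMap U) adjMap_compA.

Lemma adjMapM (phi psi : adjMap U) u : (phi * psi) u = phi (psi u).
Proof. by []. Qed.

Lemma adjMap_ginv (phi psi : adjMap U) : adjoint phi psi -> is_ginv phi psi.
Proof.
move=> h; split; apply: adjMap_ext => u; first exact: (adjoint_regular h).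
exact: (adjoint_regular (adjoint_sym h)).
Qed.

Lemma adjMap_adj (phi : adjMap U) : exists psi : adjMap U, adjoint phi psi.
Proof.
case: (adj_funP phi) => psi h.
have psiP : adjointable psi by exists phi; exact: adjoint_sym.
by exists (AdjMap psiP).
Qed.

Lemma adjMap_idem (e : adjMap U) : e * e = e -> adjoint e e.
Proof.
move=> ee; have [e' h] := adjMap_adj e.
have eeE v : e (e v) = e v by rewrite -adjMapM ee.
suff E u : e u = e' (e u).
  by move=> u v; rewrite [e v]E h (adjoint_sym h) -E.
apply: rpair_anti.
  by rewrite h eeE ract_rpair.
rewrite -(adjoint_sym h) eeE -(adjointable_ract (adj_funP e')).
by rewrite ract_rpair.
Qed.

Lemma adjMap_idemC (e f : adjMap U) : e * e = e -> f * f = f -> e * f = f * e.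
Proof.
move=> ee ff; have he := adjMap_idem ee; have hf := adjMap_idem ff.
have hef : adjoint (e * f) (f * e) by exact: (adjoint_comp he hf).
have ef : (e * f) * (e * f) = e * f.
  have [H _] := adjMap_ginv hef; rewrite -[RHS]H.
  by rewrite !mulgA -(mulgA e f f) ff -(mulgA (e * f) e e) ee.
apply: adjMap_ext => u.
exact: (adjoint_uniq (adjMap_idem ef) hef).
Qed.

Lemma adjMap_ginv_ex1 (phi : adjMap U) : exists! psi : adjMap U, is_ginv phi psi.
Proof.
have [a /adjMap_ginv ha] := adjMap_adj phi; exists a; split=> // b hb.
have [a1 a2] := ha; have [b1 b2] := hb.
have ia : (a * phi) * (a * phi) = a * phi by rewrite mulgA a2.
have ib : (b * phi) * (b * phi) = b * phi by rewrite mulgA b2.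
have ja : (phi * a) * (phi * a) = phi * a by rewrite mulgA a1.
have jb : (phi * b) * (phi * b) = phi * b by rewrite mulgA b1.
transitivity (a * phi * b).
  rewrite -{1}a2 -{1}b1 -!mulgA (mulgA phi b) (adjMap_idemC jb ja).
  by rewrite !mulgA a2.
rewrite -{1}b2 !mulgA -(mulgA (a * phi)) (adjMap_idemC ia ib).
by rewrite -!mulgA (mulgA phi a) (mulgA (phi * a)) a1 mulgA b2.
Qed.

HB.instance Definition _ := Semigroup_isInverse.Build (adjMap U) adjMap_ginv_ex1.

End AdjointableTheory.

Record inverseCorr (S T : inverseSemigroup) := InverseCorr {
  corr_set :> rightInverseSet T;
  theta : {multiplicative S -> adjMap corr_set}
}.

Definition lact (S T : inverseSemigroup) (U : inverseCorr S T) (s : S) (u : U)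
  : U := theta U s u.

Definition nondegenerate (S T : inverseSemigroup) (U : inverseCorr S T) : Prop :=
  forall u : U, exists (s : S) (u' : U), u = lact s u'.

Record corrMap (S T : inverseSemigroup) (U V : inverseCorr S T) := CorrMap {
  cmap_fun :> U -> V;
  cmap_lact : forall s u, cmap_fun (lact s u) = lact s (cmap_fun u);
  cmap_rpair : forall u u', rpair (cmap_fun u) (cmap_fun u') = rpair u u'
}.

Section InverseCorrTheory.
Variables (S T : inverseSemigroup) (U : inverseCorr S T).
Implicit Types (u v : U) (s : S).

Lemma lactM s s' u : lact (s * s') u = lact s (lact s' u).
Proof. by rewrite /lact gmulfM. Qed.

Lemma lact_ract s u t : lact s (ract u t) = ract (lact s u) t.
Proof. by rewrite /lact (adjointable_ract (adj_funP _)). Qed.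

(* A semigroup homomorphism between inverse semigroups preserves [star], and in
   [adjMap U] generalized inverses are adjoints. *)
Lemma lact_adjoint s : adjoint (@lact S T U s) (@lact S T U (star s)).
Proof.
have [psi h] := adjMap_adj (theta U s).
suff -> : @lact S T U (star s) = psi by [].
congr (adj_fun _); rewrite -(star_uniq (adjMap_ginv h)).
by apply/esym/star_uniq; split; rewrite -!gmulfM ?mulKstar ?mulstarK.
Qed.

Lemma rpair_lact s u v : rpair v (lact s u) = rpair (lact (star s) v) u.
Proof. by rewrite lact_adjoint. Qed.

Lemma rpairl_lact s u v : rpair (lact s v) u = rpair v (lact (star s) u).
Proof. by rewrite rpair_lact starK. Qed.

End InverseCorrTheory.

Lemma corrMap_ext (S T : inverseSemigroup) (U V : inverseCorr S T)
  (sigma tau : corrMap U V) : sigma =1 tau -> sigma = tau.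
Proof.
case: sigma tau => f f1 f2 [g g1 g2] /= /funext fg.
case: g / fg g1 g2 => g1 g2.
by rewrite (Prop_irrelevance f1 g1) (Prop_irrelevance f2 g2).
Qed.

Definition corrMap_id (S T : inverseSemigroup) (U : inverseCorr S T) :
    corrMap U U :=
  @CorrMap S T U U id (fun _ _ => erefl) (fun _ _ => erefl).

Section CorrMapComp.
Variables (S T : inverseSemigroup) (U V W : inverseCorr S T).
Variables (tau : corrMap V W) (sigma : corrMap U V).

Lemma corrMap_comp_lact s u : (tau \o sigma) (lact s u) = lact s (tau (sigma u)).
Proof. by rewrite /= !cmap_lact. Qed.

Lemma corrMap_comp_rpair u u' :
  rpair ((tau \o sigma) u) ((tau \o sigma) u') = rpair u u'.
Proof. by rewrite /= !cmap_rpair. Qed.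

Definition corrMap_comp : corrMap U W :=
  CorrMap corrMap_comp_lact corrMap_comp_rpair.

End CorrMapComp.

Section UnitCorr.
Variable S : inverseSemigroup.
Implicit Types s t u v : S.

Definition unit_rset : rightSet S :=
  @RightSet S S (fun s t => s * t) (fun u t t' => esym (mulgA u t t')).

Lemma unit_rpair_ract u u' t : star u * (u' * t) = star u * u' * t.
Proof. exact: mulgA. Qed.

Lemma unit_rpair_star u u' : star (star u * u') = star u' * u.
Proof. by rewrite starM starK. Qed.

Lemma unit_ract_rpair u : u * (star u * u) = u.
Proof. by rewrite mulgA mulKstar. Qed.

Definition unit_rreg : rightRegularSet S :=
  @RightRegularSet S unit_rset (fun s s' => star s * s')
    unit_rpair_ract unit_rpair_star unit_ract_rpair.

Lemma unit_rpair_anti u u' :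
  u * (star u' * u) = u -> u' * (star u * u') = u' -> u = u'.
Proof.
rewrite !mulgA => uE u'E; rewrite -(starK u) ; apply: star_uniq; split=> //.
by rewrite -[RHS](f_equal (@star S) uE) !starM !starK mulgA.
Qed.

Definition unit_rinv : rightInverseSet S :=
  @RightInverseSet S unit_rreg unit_rpair_anti.

Lemma unit_lact_adjointable s :
  adjointable (U := unit_rinv) (fun u : S => s * u).
Proof.
by exists (fun u : S => star s * u) => u v /=; rewrite starM starK mulgA.
Qed.

Definition unit_theta s : adjMap unit_rinv := AdjMap (unit_lact_adjointable s).

Lemma unit_thetaM : {morph unit_theta : s s' / s * s'}.
Proof. by move=> s s'; apply: adjMap_ext => u; rewrite /= -mulgA. Qed.

HB.instance Definition _ :=
  isMultiplicative.Build S (adjMap unit_rinv) unit_theta unit_thetaM.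

Definition unit_corr : inverseCorr S S := @InverseCorr S S unit_rinv unit_theta.

End UnitCorr.

Section Tensor.
Variables (S1 S2 S3 : inverseSemigroup).
Variables (U : inverseCorr S1 S2) (V : inverseCorr S2 S3).

Inductive tensor_step : U * V -> U * V -> Prop :=
  TensorStep u s v : tensor_step (ract u s, v) (u, lact s v).

(* [clos_refl_sym_trans] generates the least equivalence relation. *)
Definition tensor_rel : rel {classic (U * V)} :=
  fun x y => `[< clos_refl_sym_trans _ tensor_step x y >].

Lemma tensor_rel_refl : reflexive tensor_rel.
Proof. by move=> x; apply/asboolP/rst_refl. Qed.

Lemma tensor_rel_sym : symmetric tensor_rel.
Proof. by move=> x y; apply: asbool_equiv_eq; split; apply: rst_sym. Qed.

Lemma tensor_rel_trans : transitive tensor_rel.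
Proof.
move=> y x z /asboolP xy /asboolP yz; apply/asboolP.
exact: rst_trans xy yz.
Qed.

Canonical tensor_equiv :=
  EquivRel tensor_rel tensor_rel_refl tensor_rel_sym tensor_rel_trans.

Definition tensor_sort : Type := {eq_quot tensor_equiv}.

Definition tensor_pi (u : U) (v : V) : tensor_sort :=
  \pi_({eq_quot tensor_equiv}) ((u, v) : {classic (U * V)}).

Lemma tensor_pi_mid u s v : tensor_pi (ract u s) v = tensor_pi u (lact s v).
Proof. by apply/eqmodP/asboolP/rst_step. Qed.

(* Evaluates f on a chosen representative; independent of the choice only when
   f is balanced over S2, see [tensor_liftE]. *)
Definition tensor_lift (A : Type) (f : U -> V -> A) (x : tensor_sort) : A :=
  let p := repr x : U * V in f p.1 p.2.

Lemma tensor_liftE (A : Type) (f : U -> V -> A) :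
  (forall u s v, f (ract u s) v = f u (lact s v)) ->
  forall u v, tensor_lift f (tensor_pi u v) = f u v.
Proof.
move=> fP u v; rewrite /tensor_lift /tensor_pi.
case: piP => -[u' v'] /eqmodP/asboolP h /=.
suff H x y : clos_refl_sym_trans _ tensor_step x y -> f x.1 x.2 = f y.1 y.2.
  by rewrite -(H _ _ h).
by elim=> {x y} [_ _ [] //|//|? ? _ ->//|? ? ? _ -> _ ->].
Qed.

Lemma tensorP (P : tensor_sort -> Prop) :
  (forall u v, P (tensor_pi u v)) -> forall x, P x.
Proof.
by move=> h x; rewrite -[x]reprK; case: (repr x) => u v; exact: h.
Qed.

Definition tensor_ract (x : tensor_sort) (t : S3) : tensor_sort :=
  tensor_lift (fun u v => tensor_pi u (ract v t)) x.

Lemma tensor_ractE u v t : tensor_ract (tensor_pi u v) t = tensor_pi u (ract v t).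
Proof.
rewrite /tensor_ract tensor_liftE // => {}u s {}v.
by rewrite tensor_pi_mid lact_ract.
Qed.

Lemma tensor_ractM x t t' :
  tensor_ract (tensor_ract x t) t' = tensor_ract x (t * t').
Proof. by elim/tensorP: x => u v; rewrite !tensor_ractE ractM. Qed.

Definition tensor_rset : rightSet S3 := RightSet tensor_ractM.

Definition tensor_rpair (x' x : tensor_sort) : S3 :=
  tensor_lift (fun u' v' =>
    tensor_lift (fun u v => rpair v' (lact (rpair u' u) v)) x) x'.

Lemma tensor_rpairE u' v' u v :
  tensor_rpair (tensor_pi u' v') (tensor_pi u v) = rpair v' (lact (rpair u' u) v).
Proof.
have E w' z' w z : tensor_lift
    (fun u v => rpair z' (lact (rpair w' u) v)) (tensor_pi w z)
    = rpair z' (lact (rpair w' w) z).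
  by rewrite tensor_liftE // => {}w s {}z; rewrite rpair_ract lactM.
rewrite /tensor_rpair tensor_liftE ?E // => {}u' s {}v'.
by rewrite !E ractl_rpair lactM rpairl_lact.
Qed.

Lemma tensor_rpair_ract x' x t :
  tensor_rpair x' (tensor_ract x t) = tensor_rpair x' x * t.
Proof.
elim/tensorP: x => u v; elim/tensorP: x' => u' v'.
by rewrite tensor_ractE !tensor_rpairE lact_ract rpair_ract.
Qed.

Lemma tensor_rpair_star x x' : star (tensor_rpair x x') = tensor_rpair x' x.
Proof.
elim/tensorP: x => u v; elim/tensorP: x' => u' v'.
by rewrite !tensor_rpairE rpair_star rpairl_lact rpair_star.
Qed.

Lemma tensor_pi_rpair u v : tensor_pi u (lact (rpair u u) v) = tensor_pi u v.
Proof. by rewrite -tensor_pi_mid ract_rpair. Qed.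

Lemma tensor_ract_rpair x : tensor_ract x (tensor_rpair x x) = x.
Proof.
elim/tensorP: x => u v; rewrite tensor_ractE tensor_rpairE.
set p := rpair u u; have pp : p * p = p by exact: rpairuu.
rewrite -tensor_pi_rpair -/p lact_ract.
have -> : rpair v (lact p v) = rpair (lact p v) (lact p v).
  by rewrite rpairl_lact (star_idem pp) -lactM pp.
by rewrite ract_rpair tensor_pi_rpair.
Qed.

Definition tensor_rreg : rightRegularSet S3 :=
  @RightRegularSet S3 tensor_rset tensor_rpair
    tensor_rpair_ract tensor_rpair_star tensor_ract_rpair.

Lemma rreg_anti_eq (T : inverseSemigroup) (W : rightRegularSet T) (x x' : W) :
  ract x (rpair x' x) = x -> ract x' (rpair x x') = x' ->
  rpair x' x = rpair x x /\ rpair x' x' = rpair x x.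
Proof.
move=> xE x'E; set c := rpair x' x.
have cc : c * c = c by rewrite -rpair_ract xE.
have cs : rpair x x' = c by rewrite -rpair_star -/c star_idem.
have exc : rpair x x * c = rpair x x by rewrite -rpair_ract xE.
have ex : c * rpair x x = c by rewrite -rpair_ract ract_rpair.
have exc' : rpair x' x' * c = rpair x' x' by rewrite -cs -rpair_ract x'E.
have ex' : c * rpair x' x' = c by rewrite -cs -rpair_ract ract_rpair.
have H (w : W) : rpair w w * rpair w w = rpair w w.
  by rewrite -rpair_ract ract_rpair.
by split; [rewrite -ex idemC | rewrite -exc' idemC // ex' -ex idemC].
Qed.

Lemma tensor_rpair_anti (x x' : tensor_rreg) :
  ract x (rpair x' x) = x -> ract x' (rpair x x') = x' -> x = x'.
Proof.
move=> xE x'E.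
have [] := rreg_anti_eq xE x'E; have [] := rreg_anti_eq x'E xE => {xE x'E}.
elim/tensorP: x => u v; elim/tensorP: x' => u' v'; rewrite /= !tensor_rpairE.
(* Normalise v and v' so that <u|u>v = v and <u'|u'>v' = v'. *)
wlog: v v' / lact (rpair u u) v = v /\ lact (rpair u' u') v' = v'.
  move=> W; rewrite -(tensor_pi_rpair u v) -(tensor_pi_rpair u' v').
  have K (w : U) : star (rpair w w) = rpair w w by rewrite star_idem ?rpairuu.
  have L (w w' : U) : rpair w w * rpair w w' = rpair w w'.
    by rewrite -{1}(K w) -ractl_rpair ract_rpair.
  have M (w w' : U) : rpair w w' * rpair w' w' = rpair w w'.
    by rewrite -rpair_ract ract_rpair.
  move=> h1 h2 h3 h4; apply: W; rewrite ?rpairl_lact ?K -?lactM ?rpairuu //;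
    by rewrite ?mulgA ?L ?M ?rpairuu ?L ?M.
case=> pv pv'; rewrite pv pv'; set s := rpair u' u.
have -> : rpair u u' = star s by rewrite rpair_star.
move=> h1 _ h3 h4.
(* now all four pairings of u (x) v and u' (x) v' agree *)
have vE : v = lact (star s) v'.
  apply: rpair_anti; first by rewrite rpairl_lact starK h3 ract_rpair.
  by rewrite h1 -lact_ract ract_rpair.
have v'E : v' = lact s v.
  apply: rpair_anti; first by rewrite rpairl_lact h1 ract_rpair.
  by rewrite h3 -h4 -lact_ract h4 ract_rpair.
have uE : ract u (star s * s) = ract u' s.
  have E : rpair (ract u' s) (ract u (star s * s)) = star s * s.
    by rewrite rpair_ract ractl_rpair -/s !mulgA mulstarK.
  apply: rpair_anti; rewrite -?(rpair_star (ract u' s)) E.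
    by rewrite ractM mulgA mulstarK.
  by rewrite starM starK ractM mulgA mulKstar.
by rewrite [in RHS]v'E -tensor_pi_mid -uE tensor_pi_mid lactM -v'E -vE.
Qed.

Definition tensor_rinv : rightInverseSet S3 :=
  @RightInverseSet S3 tensor_rreg tensor_rpair_anti.

Definition tensor_lact (s : S1) (x : tensor_sort) : tensor_sort :=
  tensor_lift (fun u v => tensor_pi (lact s u) v) x.

Lemma tensor_lactE s u v : tensor_lact s (tensor_pi u v) = tensor_pi (lact s u) v.
Proof.
rewrite /tensor_lact tensor_liftE // => {}u t {}v.
by rewrite lact_ract tensor_pi_mid.
Qed.

Lemma tensor_lact_adjointable s : adjointable (U := tensor_rinv) (tensor_lact s).
Proof.
exists (tensor_lact (star s)) => x x' /=.
elim/tensorP: x => u v; elim/tensorP: x' => u' v'.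
by rewrite !tensor_lactE !tensor_rpairE rpairl_lact starK.
Qed.

Definition tensor_theta (s : S1) : adjMap tensor_rinv :=
  AdjMap (tensor_lact_adjointable s).

Lemma tensor_thetaM : {morph tensor_theta : s s' / s * s'}.
Proof.
move=> s s'; apply: adjMap_ext; elim/tensorP => u v /=.
by rewrite !tensor_lactE lactM.
Qed.

HB.instance Definition _ :=
  isMultiplicative.Build S1 (adjMap tensor_rinv) tensor_theta tensor_thetaM.

Definition tensor : inverseCorr S1 S3 :=
  @InverseCorr S1 S3 tensor_rinv tensor_theta.

Definition tens (u : U) (v : V) : tensor := tensor_pi u v.

End Tensor.

(* [vcomp beta alpha] is beta after alpha; 1-cells compose in diagrammatic
   order, and the associator goes from f(gh) to (fg)h as in Bénabou. *)
Record bicatData := BicatData {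
  ob : Type;
  hom : ob -> ob -> Type;
  cell : forall a b, hom a b -> hom a b -> Type;
  id2 : forall a b (f : hom a b), cell f f;
  vcomp : forall a b (f g h : hom a b), cell g h -> cell f g -> cell f h;
  id1 : forall a, hom a a;
  hcomp : forall a b c, hom a b -> hom b c -> hom a c;
  hcomp2 : forall a b c (f f' : hom a b) (g g' : hom b c),
    cell f f' -> cell g g' -> cell (hcomp f g) (hcomp f' g');
  associator : forall a b c d (f : hom a b) (g : hom b c) (h : hom c d),
    cell (hcomp f (hcomp g h)) (hcomp (hcomp f g) h);
  runitor : forall a b (f : hom a b), cell (hcomp f (id1 b)) f;
  lunitor : forall a b (f : hom a b), cell (hcomp (id1 a) f) f
}.

Definition invertible_cell (B : bicatData) (a b : ob B) (f g : hom a b)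
    (alpha : cell f g) : Prop :=
  exists beta : cell g f, vcomp beta alpha = id2 f /\ vcomp alpha beta = id2 g.

Record is_bicategory (B : bicatData) : Prop := IsBicategory {
  vcomp1l : forall (a b : ob B) (f g : hom a b) (alpha : cell f g),
    vcomp (id2 g) alpha = alpha;
  vcomp1r : forall (a b : ob B) (f g : hom a b) (alpha : cell f g),
    vcomp alpha (id2 f) = alpha;
  vcompA : forall (a b : ob B) (f g h k : hom a b)
      (alpha : cell f g) (beta : cell g h) (gamma : cell h k),
    vcomp gamma (vcomp beta alpha) = vcomp (vcomp gamma beta) alpha;
  hcomp2_id : forall (a b c : ob B) (f : hom a b) (g : hom b c),
    hcomp2 (id2 f) (id2 g) = id2 (hcomp f g);
  hcomp2_vcomp : forall (a b c : ob B) (f f' f'' : hom a b) (g g' g'' : hom b c)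
      (alpha : cell f f') (alpha' : cell f' f'')
      (beta : cell g g') (beta' : cell g' g''),
    hcomp2 (vcomp alpha' alpha) (vcomp beta' beta) =
    vcomp (hcomp2 alpha' beta') (hcomp2 alpha beta);
  associator_nat : forall (a b c d : ob B)
      (f f' : hom a b) (g g' : hom b c) (h h' : hom c d)
      (alpha : cell f f') (beta : cell g g') (gamma : cell h h'),
    vcomp (associator f' g' h') (hcomp2 alpha (hcomp2 beta gamma)) =
    vcomp (hcomp2 (hcomp2 alpha beta) gamma) (associator f g h);
  runitor_nat : forall (a b : ob B) (f f' : hom a b) (alpha : cell f f'),
    vcomp (runitor f') (hcomp2 alpha (id2 (id1 b))) = vcomp alpha (runitor f);
  lunitor_nat : forall (a b : ob B) (f f' : hom a b) (alpha : cell f f'),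
    vcomp (lunitor f') (hcomp2 (id2 (id1 a)) alpha) = vcomp alpha (lunitor f);
  associator_inv : forall (a b c d : ob B)
      (f : hom a b) (g : hom b c) (h : hom c d),
    invertible_cell (associator f g h);
  runitor_inv : forall (a b : ob B) (f : hom a b), invertible_cell (runitor f);
  lunitor_inv : forall (a b : ob B) (f : hom a b), invertible_cell (lunitor f);
  pentagon : forall (a b c d e : ob B)
      (f : hom a b) (g : hom b c) (h : hom c d) (k : hom d e),
    vcomp (associator (hcomp f g) h k) (associator f g (hcomp h k)) =
    vcomp (hcomp2 (associator f g h) (id2 k))
      (vcomp (associator f (hcomp g h) k)
             (hcomp2 (id2 f) (associator g h k)));
  triangle : forall (a b c : ob B) (f : hom a b) (g : hom b c),
    vcomp (hcomp2 (runitor f) (id2 g)) (associator f (id1 b) g) =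
    hcomp2 (id2 f) (lunitor g)
}.

Record ndCorr (S T : inverseSemigroup) := NdCorr {
  nd_corr :> inverseCorr S T;
  nd_corrP : nondegenerate nd_corr
}.

(* The inputs are the parts of the data whose existence is not a matter of
   definition: non-degeneracy of tensor products and of units, and the 2-arrows
   that are specified by their values on elementary tensors. *)
Definition IC_data
  (tensor_nd : forall (S1 S2 S3 : inverseSemigroup)
     (U1 : ndCorr S1 S2) (U2 : ndCorr S2 S3), nondegenerate (tensor U1 U2))
  (unit_nd : forall S : inverseSemigroup, nondegenerate (unit_corr S))
  (tensor_map : forall (S1 S2 S3 : inverseSemigroup)
     (U1 U1' : ndCorr S1 S2) (U2 U2' : ndCorr S2 S3),
     corrMap U1 U1' -> corrMap U2 U2' ->
     corrMap (tensor U1 U2) (tensor U1' U2'))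
  (assoc_map : forall (S1 S2 S3 S4 : inverseSemigroup)
     (U1 : ndCorr S1 S2) (U2 : ndCorr S2 S3) (U3 : ndCorr S3 S4),
     corrMap (tensor U1 (tensor U2 U3)) (tensor (tensor U1 U2) U3))
  (runit_map : forall (S T : inverseSemigroup) (U : ndCorr S T),
     corrMap (tensor U (unit_corr T)) U)
  (lunit_map : forall (S T : inverseSemigroup) (U : ndCorr S T),
     corrMap (tensor (unit_corr S) U) U) : bicatData :=
  {| ob := inverseSemigroup;
     hom := ndCorr;
     cell := fun S T (U V : ndCorr S T) => corrMap U V;
     id2 := fun S T (U : ndCorr S T) => corrMap_id U;
     vcomp := fun S T (U V W : ndCorr S T) (tau : corrMap V W)
       (sigma : corrMap U V) => corrMap_comp tau sigma;
     id1 := fun S => NdCorr (unit_nd S);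
     hcomp := fun S1 S2 S3 (U1 : ndCorr S1 S2) (U2 : ndCorr S2 S3) =>
       NdCorr (tensor_nd S1 S2 S3 U1 U2);
     hcomp2 := tensor_map;
     associator := assoc_map;
     runitor := runit_map;
     lunitor := lunit_map |}.

(* Main.v *)
Require Import Defs.
From mathcomp Require Import all_boot.
From mathcomp Require Import boolp.

(** A map of right inverse T-sets that preserves pairings is controlled by the
    pairing alone: [u = v] as soon as [<u|u> = <u|v> = <v|v>], so any two
    expressions in values of the map coincide once their mutual pairings do.
    Three things follow from this with hardly any work.

    - A function of two variables whose pairings are those of elementary tensors
      is automatically balanced, hence descends to the tensor product
      ([tensor_balanced], [tensor_corrMap]). All structural 2-arrows are built
      in this way, so for each of them the pairings and the equivariance have to
      be checked on elementary tensors, but not the balancedness. Only the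
      associator, whose source is an iterated tensor product, requires one
      direct verification of balancedness ([assoc_funE]).
    - A correspondence map commutes with the right action ([cmap_ract]), which
      is the naturality of the right unitor.
    - A correspondence map is injective ([cmap_inj]), and the inverse of a
      bijective one is again a correspondence map, so a 2-arrow is invertible
      as soon as it is surjective ([corrMap_surj_inv]). The associator hits
      every elementary tensor, the right unitor hits [u] because
      [u = u <u|u>], and the left unitor is onto exactly because the
      correspondence is non-degenerate.

    The remaining laws are equalities between correspondence maps out of
    (iterated) tensor products, and both sides agree on elementary tensors; for
    the triangle this agreement is the relation [ut (x) v = u (x) tv] itself. *)

Set Implicit Arguments.
Unset Strict Implicit.
Unset Printing Implicit Defensive.

Local Open Scope group_scope.

(** * Correspondence maps *)

Section CorrMaps.
Variables (S T : inverseSemigroup) (U V : inverseCorr S T).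
Variable sigma : corrMap U V.

(** All pairings among [sigma (u t)] and [sigma(u) t] equal [t^* <u|u> t]. *)
Lemma cmap_ract u t : sigma (ract u t) = ract (sigma u) t.
Proof.
by apply: rpair_eq;
  do 6?[rewrite cmap_rpair | rewrite rpair_ract | rewrite ractl_rpair].
Qed.

Lemma cmap_inj : injective sigma.
Proof.
move=> u v uv; have E w : rpair w u = rpair w v.
  by rewrite -!(cmap_rpair sigma) uv.
exact: rpair_injr.
Qed.

Lemma corrMap_surj_inv : (forall v, exists u, sigma u = v) ->
  exists tau : corrMap V U, corrMap_comp tau sigma = corrMap_id U /\
    corrMap_comp sigma tau = corrMap_id V.
Proof.
move=> /choice[g gK].
have g_lact s v : g (lact s v) = lact s (g v).
  by apply: cmap_inj; rewrite cmap_lact !gK.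
have g_rpair v v' : rpair (g v) (g v') = rpair v v'.
  by rewrite -(cmap_rpair sigma) !gK.
exists (CorrMap g_lact g_rpair); split; apply: corrMap_ext => x /=.
  by apply: cmap_inj; rewrite gK.
exact: gK.
Qed.

End CorrMaps.

Lemma corrMap_compE (S T : inverseSemigroup) (U V W : inverseCorr S T)
    (tau : corrMap V W) (sigma : corrMap U V) u :
  corrMap_comp tau sigma u = tau (sigma u).
Proof. by []. Qed.

(** * Correspondence maps out of a tensor product *)

Section TensorLift.
Variables (S1 S2 S3 : inverseSemigroup).
Variables (U : inverseCorr S1 S2) (V : inverseCorr S2 S3).

(** The defining equations of the tensor product, read in the structure
    [tensor U V] and not in the underlying quotient, so that they rewrite terms
    whose actions and pairings are those of a correspondence. *)
Lemma tens_lact s (u : U) (v : V) : lact s (tens u v) = tens (lact s u) v.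
Proof. exact: tensor_lactE. Qed.

Lemma tens_rpair (u u' : U) (v v' : V) :
  rpair (tens u v) (tens u' v') = rpair v (lact (rpair u u') v').
Proof. exact: tensor_rpairE. Qed.

Lemma tens_mid (u : U) s (v : V) : tens (ract u s) v = tens u (lact s v).
Proof. exact: tensor_pi_mid. Qed.

Lemma tens_ract (u : U) (v : V) t : ract (tens u v) t = tens u (ract v t).
Proof. exact: tensor_ractE. Qed.

Lemma tens_ind (P : tensor U V -> Prop) :
  (forall u v, P (tens u v)) -> forall x, P x.
Proof. exact: tensorP. Qed.

Lemma corrMap_tens_ext (W : inverseCorr S1 S3)
    (sigma tau : corrMap (tensor U V) W) :
  (forall u v, sigma (tens u v) = tau (tens u v)) -> sigma = tau.
Proof. by move=> h; apply: corrMap_ext; elim/tens_ind. Qed.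

Lemma tensor_nondegenerate : nondegenerate U -> nondegenerate (tensor U V).
Proof.
move=> Und; elim/tens_ind => u v; have [s [u' ->]] := Und u.
by exists s, (tens u' v); rewrite tens_lact.
Qed.

Section Lift.
Variables (W : inverseCorr S1 S3) (f : U -> V -> W).
Hypothesis f_lact : forall s u v, f (lact s u) v = lact s (f u v).
Hypothesis f_rpair : forall u v u' v',
  rpair (f u v) (f u' v') = rpair (tens u v) (tens u' v').

(** The pairings of [f (u s) v] and [f u (s v)] are those of one and the same
    element [us (x) v = u (x) sv], so the two values coincide. *)
Lemma tensor_balanced u s v : f (ract u s) v = f u (lact s v).
Proof. by apply: rpair_eq; rewrite !f_rpair tens_mid. Qed.

Definition tensor_fun : tensor U V -> W := tensor_lift f.

Lemma tensor_funE u v : tensor_fun (tens u v) = f u v.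
Proof. exact: (tensor_liftE tensor_balanced). Qed.

Lemma tensor_fun_lact s x : tensor_fun (lact s x) = lact s (tensor_fun x).
Proof. by elim/tens_ind: x => u v; rewrite tens_lact !tensor_funE. Qed.

Lemma tensor_fun_rpair x y : rpair (tensor_fun x) (tensor_fun y) = rpair x y.
Proof.
elim/tens_ind: x => u v; elim/tens_ind: y => u' v'.
by rewrite !tensor_funE f_rpair.
Qed.

Definition tensor_corrMap : corrMap (tensor U V) W :=
  CorrMap tensor_fun_lact tensor_fun_rpair.

Lemma tensor_corrMapE u v : tensor_corrMap (tens u v) = f u v.
Proof. exact: tensor_funE. Qed.

End Lift.
End TensorLift.

(** * Horizontal composition of correspondence maps *)

Section TensorMap.
Variables (S1 S2 S3 : inverseSemigroup).
Variables (U U' : inverseCorr S1 S2) (V V' : inverseCorr S2 S3).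
Variables (sigma : corrMap U U') (tau : corrMap V V').

Let f u v := tens (sigma u) (tau v).

Lemma tensor_map_lact s u v : f (lact s u) v = lact s (f u v).
Proof. by rewrite /f tens_lact cmap_lact. Qed.

Lemma tensor_map_rpair u v u' v' :
  rpair (f u v) (f u' v') = rpair (tens u v) (tens u' v').
Proof. by rewrite /f !tens_rpair cmap_rpair -cmap_lact cmap_rpair. Qed.

Definition tensor_map : corrMap (tensor U V) (tensor U' V') :=
  tensor_corrMap tensor_map_lact tensor_map_rpair.

Lemma tensor_mapE u v : tensor_map (tens u v) = tens (sigma u) (tau v).
Proof. exact: tensor_corrMapE. Qed.

End TensorMap.

(** * The associator *)

Section Associator.
Variables (S1 S2 S3 S4 : inverseSemigroup).
Variables (U1 : inverseCorr S1 S2) (U2 : inverseCorr S2 S3).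
Variable (U3 : inverseCorr S3 S4).

(** The associator with its first argument fixed. The target comes with an
    action of [S1] and none of [S2], so this is no correspondence map and is
    lifted as a mere balanced function. *)
Definition assoc_fun (u1 : U1) : tensor U2 U3 -> tensor (tensor U1 U2) U3 :=
  tensor_lift (fun u2 u3 => tens (tens u1 u2) u3).

Lemma assoc_funE u1 u2 u3 :
  assoc_fun u1 (tens u2 u3) = tens (tens u1 u2) u3.
Proof.
apply: (tensor_liftE (f := fun u2 u3 => tens (tens u1 u2) u3)) => {}u2 s {}u3.
by rewrite -tens_ract tens_mid.
Qed.

Lemma assoc_fun_lact s u1 x : assoc_fun (lact s u1) x = lact s (assoc_fun u1 x).
Proof. by elim/tens_ind: x => u2 u3; rewrite !assoc_funE !tens_lact. Qed.

Lemma assoc_fun_rpair u x u' x' :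
  rpair (assoc_fun u x) (assoc_fun u' x') = rpair (tens u x) (tens u' x').
Proof.
elim/tens_ind: x => v w; elim/tens_ind: x' => v' w'.
(* Exactly three times: a fourth rewriting would see through the left action on
   [tens v' w'] and replace this element by a chosen representative. *)
by rewrite !assoc_funE 3!tens_rpair tens_lact tens_rpair.
Qed.

Definition assoc_map :
    corrMap (tensor U1 (tensor U2 U3)) (tensor (tensor U1 U2) U3) :=
  tensor_corrMap assoc_fun_lact assoc_fun_rpair.

Lemma assoc_mapE u1 u2 u3 :
  assoc_map (tens u1 (tens u2 u3)) = tens (tens u1 u2) u3.
Proof. by rewrite /assoc_map tensor_corrMapE assoc_funE. Qed.

Lemma assoc_map_surj y : exists x, assoc_map x = y.
Proof.
elim/tens_ind: y => x u3; elim/tens_ind: x => u1 u2.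
by exists (tens u1 (tens u2 u3)); rewrite assoc_mapE.
Qed.

End Associator.

(** * The unitors *)

Lemma unit_nondegenerate (S : inverseSemigroup) : nondegenerate (unit_corr S).
Proof. by move=> s; exists (s * star s), s; rewrite -[LHS]mulKstar. Qed.

Section Unitors.
Variables (S T : inverseSemigroup) (U : inverseCorr S T).

Lemma runit_lact s (u : U) (t : unit_corr T) :
  ract (lact s u) t = lact s (ract u t).
Proof. by rewrite lact_ract. Qed.

Lemma runit_rpair (u : U) (t : unit_corr T) u' (t' : unit_corr T) :
  rpair (ract u t) (ract u' t') = rpair (tens u t) (tens u' t').
Proof. by rewrite tens_rpair rpair_ract ractl_rpair -mulgA. Qed.

Definition runit_map : corrMap (tensor U (unit_corr T)) U :=
  tensor_corrMap runit_lact runit_rpair.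

Lemma runit_mapE u (t : unit_corr T) : runit_map (tens u t) = ract u t.
Proof. exact: tensor_corrMapE. Qed.

Lemma runit_map_surj u : exists x, runit_map x = u.
Proof.
exists (tens u (rpair u u : unit_corr T)).
by rewrite runit_mapE ract_rpair.
Qed.

Lemma lunit_lact s (s' : unit_corr S) (u : U) :
  lact (lact s s' : S) u = lact s (lact (s' : S) u).
Proof. exact: lactM. Qed.

Lemma lunit_rpair (s : unit_corr S) (u : U) (s' : unit_corr S) u' :
  rpair (lact (s : S) u) (lact (s' : S) u') = rpair (tens s u) (tens s' u').
Proof. by rewrite tens_rpair rpairl_lact -lactM. Qed.

Definition lunit_map : corrMap (tensor (unit_corr S) U) U :=
  tensor_corrMap lunit_lact lunit_rpair.

Lemma lunit_mapE (s : unit_corr S) u : lunit_map (tens s u) = lact (s : S) u.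
Proof. exact: tensor_corrMapE. Qed.

Lemma lunit_map_surj : nondegenerate U -> forall u, exists x, lunit_map x = u.
Proof.
move=> Und u; have [s [u' ->]] := Und u.
by exists (tens (s : unit_corr S) u'); rewrite lunit_mapE.
Qed.

End Unitors.

(** * The bicategory of inverse semigroups *)

Theorem theorem5p12 :
  exists
    (tensor_nd : forall (S1 S2 S3 : inverseSemigroup)
       (U1 : ndCorr S1 S2) (U2 : ndCorr S2 S3), nondegenerate (tensor U1 U2))
    (unit_nd : forall S : inverseSemigroup, nondegenerate (unit_corr S))
    (tensor_map : forall (S1 S2 S3 : inverseSemigroup)
       (U1 U1' : ndCorr S1 S2) (U2 U2' : ndCorr S2 S3),
       corrMap U1 U1' -> corrMap U2 U2' ->
       corrMap (tensor U1 U2) (tensor U1' U2'))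
    (assoc_map : forall (S1 S2 S3 S4 : inverseSemigroup)
       (U1 : ndCorr S1 S2) (U2 : ndCorr S2 S3) (U3 : ndCorr S3 S4),
       corrMap (tensor U1 (tensor U2 U3)) (tensor (tensor U1 U2) U3))
    (runit_map : forall (S T : inverseSemigroup) (U : ndCorr S T),
       corrMap (tensor U (unit_corr T)) U)
    (lunit_map : forall (S T : inverseSemigroup) (U : ndCorr S T),
       corrMap (tensor (unit_corr S) U) U),
    (forall (S1 S2 S3 : inverseSemigroup)
       (U1 U1' : ndCorr S1 S2) (U2 U2' : ndCorr S2 S3)
       (sigma1 : corrMap U1 U1') (sigma2 : corrMap U2 U2') (u1 : U1) (u2 : U2),
       tensor_map S1 S2 S3 U1 U1' U2 U2' sigma1 sigma2 (tens u1 u2) =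
       tens (sigma1 u1) (sigma2 u2)) /\
    (forall (S1 S2 S3 S4 : inverseSemigroup)
       (U1 : ndCorr S1 S2) (U2 : ndCorr S2 S3) (U3 : ndCorr S3 S4)
       (u1 : U1) (u2 : U2) (u3 : U3),
       assoc_map S1 S2 S3 S4 U1 U2 U3 (tens u1 (tens u2 u3)) =
       tens (tens u1 u2) u3) /\
    (forall (S T : inverseSemigroup) (U : ndCorr S T) (u : U) (t : T),
       runit_map S T U (tens u (t : unit_corr T)) = ract u t) /\
    (forall (S T : inverseSemigroup) (U : ndCorr S T) (s : S) (u : U),
       lunit_map S T U (tens (s : unit_corr S) u) = lact s u) /\
    is_bicategory
      (IC_data tensor_nd unit_nd tensor_map assoc_map runit_map lunit_map).
Proof.
exists (fun S1 S2 S3 U1 U2 => tensor_nondegenerate (V := U2) (@nd_corrP _ _ U1)).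
exists unit_nondegenerate.
exists (fun S1 S2 S3 U1 U1' U2 U2' s1 s2 => tensor_map s1 s2).
exists (fun S1 S2 S3 S4 U1 U2 U3 => assoc_map U1 U2 U3).
exists (fun S T U => runit_map U), (fun S T U => lunit_map U).
split; [|split; [|split; [|split]]].
- by move=> *; rewrite tensor_mapE.
- by move=> *; rewrite assoc_mapE.
- by move=> *; rewrite runit_mapE.
- by move=> *; rewrite lunit_mapE.
split=> /=.
- by move=> *; apply: corrMap_ext.
- by move=> *; apply: corrMap_ext.
- by move=> *; apply: corrMap_ext.
- by move=> *; apply: corrMap_tens_ext => u v; rewrite tensor_mapE.
- move=> *; apply: corrMap_tens_ext => u v.
  by rewrite !(corrMap_compE, tensor_mapE).
- move=> *; apply: corrMap_tens_ext => u; elim/tens_ind => v w.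
  by rewrite !(corrMap_compE, tensor_mapE, assoc_mapE).
- move=> *; apply: corrMap_tens_ext => u t.
  by rewrite !(corrMap_compE, tensor_mapE, runit_mapE) cmap_ract.
- move=> *; apply: corrMap_tens_ext => s u.
  by rewrite !(corrMap_compE, tensor_mapE, lunit_mapE) cmap_lact.
- by move=> *; apply: corrMap_surj_inv; exact: assoc_map_surj.
- by move=> *; apply: corrMap_surj_inv; exact: runit_map_surj.
- move=> a b f; apply: corrMap_surj_inv; apply: lunit_map_surj.
  exact: nd_corrP.
- move=> *; apply: corrMap_tens_ext => u; elim/tens_ind => v.
  elim/tens_ind => w z.
  by rewrite !(corrMap_compE, tensor_mapE, assoc_mapE).
- move=> *; apply: corrMap_tens_ext => u; elim/tens_ind => t v.
  rewrite !(corrMap_compE, tensor_mapE, assoc_mapE, runit_mapE, lunit_mapE).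
  by rewrite tens_mid.
Qed.
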